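(* For any set $\mathcal{I}\subseteq B$ of pairwise incompatible pairs, there exists an optimal solution of $(D)$ that provides the exact reduced cost of each pair of $\mathcal{I}$, i.e. an optimal solution $u^*$ of $(D)$ with $r_{ij}(u^* )=R_{ij}$ for all $ij\in\mathcal{I}$.
   Context: Setting. $X_1,\dots,X_n$ are variables with finite domains $D(X_i)\subset\mathbb{Z}$, and $C$ is a constraint on them, i.e. a set of allowed tuples. A support for $C$ is an allowed tuple $\langle a_1,\dots,a_n\rangle$ with $a_i\in D(X_i)$ for all $i$. $B=\{ij : 1\le i\le n,\ j\in D(X_i)\}$ is the (finite) set of variable/value pairs, where $ij$ is short for $(i,j)$. The characteristic vector of a support is $x\in\{0,1\}^{B}$ with $x_{ij}=1$ iff $a_i=j$; $\mathcal{S}$ is the set of characteristic vectors of the supports of $C$. Each pair has a cost $c_{ij}\in\mathbb{Z}$. Ideal formulation (standing assumption): $A$ is a real $m\times|B|$ matrix (with columns $A_{ij}$, $ij\in B$) and $b\in\mathbb{R}^m$ are such that $\{x\in\mathbb{R}^{B}_+ : Ax\ge b\}=\mathrm{conv}(\mathcal{S})$. $(P)$: $z^*=\min\{cx : Ax\ge b,\ x\in\mathbb{R}^B_+\}$; $(D)$: $\max\{ub : uA\le c,\ u\in\mathbb{R}^m_+\}$. For $kl\in B$, $(P_{|kl})$ is $(P)$ with the additional constraint $x_{kl}=1$, with optimal value $z^*_{|kl}$. Feasibility (standing assumption): every pair of $B$ belongs to at least one support of $C$; hence $(P)$, $(D)$ and all $(P_{|kl})$ are feasible and bounded. For feasible $u$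 of $(D)$ the reduced cost of $kl$ is $r_{kl}(u)=c_{kl}-uA_{kl}$. $R_{kl}=z^*_{|kl}-z^*$; the reduced cost is exact when $r_{kl}(u)=R_{kl}$. Two distinct pairs $ij,kl\in B$ are incompatible if there is no support for $C$ with $X_i=j$ and $X_k=l$. *)

(* Defs.v *)
From mathcomp Require Import all_boot all_order all_algebra.
From mathcomp Require Import finmap.
From mathcomp Require Import boolp classical_sets reals.

Set Implicit Arguments.
Unset Strict Implicit.
Unset Printing Implicit Defensive.

Import Order.TTheory GRing.Theory Num.Theory.

Local Open Scope classical_set_scope.
Local Open Scope ring_scope.

Section Constraint.
Variables (n : nat) (D : 'I_n -> {fset int}) (C : set (n.-tuple int)).

(* The set B of variable/value pairs, as a dependent sum of the domains. *)
Definition pairs : finType := {i : 'I_n & D i}.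

Definition var (p : pairs) : 'I_n := tag p.
Definition value (p : pairs) : int := fsval (tagged p).

Definition is_support (a : n.-tuple int) : Prop :=
  C a /\ forall i, tnth a i \in D i.

Definition assigns (a : n.-tuple int) (p : pairs) : bool :=
  tnth a (var p) == value p.

Definition incompatible (p q : pairs) : Prop :=
  p != q /\ ~ exists a, [/\ is_support a, assigns a p & assigns a q].

End Constraint.

(* Vectors of R^B are column vectors of height #|pairs D|; the coordinate of
   the pair p is the one of index [enum_rank p]. *)
Section LinearProgram.
Variables (R : realType) (n : nat) (D : 'I_n -> {fset int}).
Variable C : set (n.-tuple int).

Definition char_vec (a : n.-tuple int) : 'cV[R]_#|pairs D| :=
  \col_k (assigns a (enum_val k : pairs D))%:R.

Definition char_vecs : set 'cV[R]_#|pairs D| :=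
  [set char_vec a | a in is_support D C].

Definition conv (d : nat) (S : set 'cV[R]_d) : set 'cV[R]_d :=
  [set x | exists (k : nat) (s : 'I_k -> 'cV[R]_d) (l : 'I_k -> R),
    [/\ forall i, S (s i), forall i, 0 <= l i, \sum_i l i = 1
      & x = \sum_i l i *: s i]].

(* The value is 0 when S has no minimum. *)
Definition min_value (S : set R) : R := xget 0 (S `&` lbound S).

Variables (m : nat) (A : 'M[R]_(m, #|pairs D|)) (b : 'cV[R]_m).
Variable c : pairs D -> int.

Definition cost_row : 'rV[R]_#|pairs D| := \row_k (c (enum_val k))%:~R.

Definition cost (x : 'cV[R]_#|pairs D|) : R := (cost_row *m x) 0 0.

Definition primal_feasible : set 'cV[R]_#|pairs D| :=
  [set x | (forall i, b i 0 <= (A *m x) i 0) /\ (forall k, 0 <= x k 0)].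

Definition primal_feasible_at (p : pairs D) : set 'cV[R]_#|pairs D| :=
  [set x | primal_feasible x /\ x (enum_rank p) 0 = 1].

Definition zopt : R := min_value [set cost x | x in primal_feasible].

Definition zopt_at (p : pairs D) : R :=
  min_value [set cost x | x in primal_feasible_at p].

Definition dual_feasible : set 'rV[R]_m :=
  [set u | (forall k, (u *m A) 0 k <= cost_row 0 k) /\ (forall i, 0 <= u 0 i)].

Definition dual_optimal (u : 'rV[R]_m) : Prop :=
  dual_feasible u /\
  forall v, dual_feasible v -> (v *m b) 0 0 <= (u *m b) 0 0.

Definition reduced_cost (u : 'rV[R]_m) (p : pairs D) : R :=
  (c p)%:~R - (u *m col (enum_rank p) A) 0 0.

Definition exact_reduced_cost (p : pairs D) : R := zopt_at p - zopt.

End LinearProgram.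

Arguments char_vecs R {n} D C _.

(* Main.v *)
Require Import Defs.
From mathcomp Require Import all_boot all_order all_algebra.
From mathcomp Require Import finmap.
From mathcomp Require Import boolp classical_sets reals.
From mathcomp Require Import ring lra.

(** Lower the cost of every pair [p] of [I] by [R_p >= 0].  A support contains at
most one pair of [I], so its cost drops by at most the one [R_p] that keeps it
above [z*]; hence [z*] is still a lower bound of the modified program, and LP
duality gives [u >= 0] with [u A <= c - R] on [I], [u A <= c] elsewhere, and
[u b >= z*].  This [u] is optimal for the original dual, and its reduced cost at
[p] in [I] is at least [R_p]; it is at most [R_p] by weak duality at an optimal
solution of the program restricted to [x_p = 1].  LP duality is derived from
Farkas' lemma, proved by Bartl's induction on the number of linear forms. *)

Set Implicit Arguments.
Unset Strict Implicit.
Unset Printing Implicit Defensive.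

Import Order.TTheory GRing.Theory Num.Theory.

Local Open Scope classical_set_scope.
Local Open Scope ring_scope.

(** * Farkas' lemma and linear programming duality *)

(** If the forms of [s] alone do not force [gamma] to be nonnegative, a witness [y] of this has
    [alpha j0 y < 0], and projecting along [y] eliminates [alpha j0]. *)
Lemma farkas (R : realFieldType) (W : lmodType R) (J : eqType) (s : seq J)
    (alpha : J -> W -> R) (gamma : W -> R) :
  uniq s -> (forall j, scalar (alpha j)) -> scalar gamma ->
  (forall x, (forall j, j \in s -> 0 <= alpha j x) -> 0 <= gamma x) ->
  exists2 l : J -> R, forall j, 0 <= l j &
    forall x, gamma x = \sum_(j <- s) l j * alpha j x.
Proof.
elim: s alpha gamma => [|j0 s IHs] alpha gamma.
  (* With no form left, [gamma] is nonnegative at both [x] and [- x], so it vanishes. *)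
  move=> _ _ gammaL gamma_ge0; exists (fun=> 0) => // x; rewrite big_nil.
  have gamma0 : gamma 0 = 0.
    by have := gammaL (-1) 0 0; rewrite scaler0 addr0 mulN1r addNr.
  have gammaN : gamma (- x) = - gamma x.
    by have := gammaL (-1) x 0; rewrite scaleN1r addr0 mulN1r gamma0 addr0.
  apply/eqP; rewrite eq_le gamma_ge0 // andbT -oppr_ge0 -gammaN.
  exact: gamma_ge0.
move=> /= /andP[j0s s_uniq] alphaL gammaL gamma_ge0.
have [IH|] := pselect
    (forall x, (forall j, j \in s -> 0 <= alpha j x) -> 0 <= gamma x).
  have [l l_ge0 lE] := IHs _ _ s_uniq alphaL gammaL IH.
  exists (fun j => if j == j0 then 0 else l j) => [j|x]; first by case: ifP.
  rewrite big_cons eqxx mul0r add0r lE; apply: eq_big_seq => j js.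
  by case: eqP js j0s => // -> ->.
move=> /existsNP[y /not_implyP[y_ge0 /negP]]; rewrite -ltNge => gy_lt0.
have ay_lt0 : alpha j0 y < 0.
  rewrite ltNge; apply: contraTN gy_lt0 => ay_ge0; rewrite -leNgt.
  by apply: gamma_ge0 => j; rewrite inE => /predU1P[->|/y_ge0].
(* [proj x] is the projection of [x] along [y] onto the kernel of [alpha j0]. *)
pose proj x := - (alpha j0 x / alpha j0 y) *: y + x.
have projE f : scalar f ->
    forall x, f (proj x) = f x - alpha j0 x / alpha j0 y * f y.
  by move=> fL x; rewrite fL mulNr addrC.
have proj_scalar f : scalar f -> scalar (f \o proj).
  move=> fL a x z /=; rewrite !projE // fL alphaL; ring.
have [||||l l_ge0 lE] := IHs (fun j => alpha j \o proj) (gamma \o proj).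
- by [].
- by move=> j; apply: proj_scalar.
- exact: proj_scalar.
(* [alpha j0] vanishes at [proj x], so its sign condition holds there. *)
- move=> x px_ge0; apply: gamma_ge0 => j; rewrite inE => /predU1P[->|/px_ge0//].
  by rewrite projE // divfK ?subrr // lt_eqF.
(* The weight forced by the identity at [y]: a negative number minus a nonnegative sum, over a
   negative number. *)
pose l0 := (gamma y - \sum_(j <- s) l j * alpha j y) / alpha j0 y.
have l0_ge0 : 0 <= l0.
  rewrite ler_ndivlMr // mul0r subr_le0; apply: le_trans (ltW gy_lt0) _.
  rewrite big_seq; apply: sumr_ge0 => j js.
  by rewrite mulr_ge0 ?y_ge0.
exists (fun j => if j == j0 then l0 else l j) => [j|x]; first by case: ifP.
rewrite big_cons eqxx.
under eq_big_seq => j js.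
  rewrite (_ : (j == j0) = false); last by apply: contraNF j0s => /eqP <-.
  over.
have := lE x; rewrite /= projE //.
under eq_bigr do rewrite projE // mulrBr mulrCA.
rewrite big_split /= sumrN -mulr_sumr /l0 => /eqP; rewrite subr_eq => /eqP ->.
ring.
Qed.

Lemma mulmx_row_col (R : pzSemiRingType) (d : nat) (u : 'rV[R]_d)
    (v : 'cV[R]_d) : (u *m v) 0 0 = \sum_k u 0 k * v k 0.
Proof. by rewrite mxE. Qed.

(** The Farkas weights of the rows of [A] form [u]; those of the sign constraints are the slacks of
    [u A <= c], and that of the scaling variable is the slack of [z <= u b]. *)
Lemma lp_bound_dual (R : realFieldType) (m d : nat) (A : 'M[R]_(m, d))
    (b : 'cV[R]_m) (c : 'rV[R]_d) (z : R) (x0 : 'cV[R]_d) :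
  (forall i, b i 0 <= (A *m x0) i 0) -> (forall k, 0 <= x0 k 0) ->
  (forall x : 'cV[R]_d, (forall i, b i 0 <= (A *m x) i 0) ->
    (forall k, 0 <= x k 0) -> z <= (c *m x) 0 0) ->
  exists u : 'rV[R]_m, [/\ forall k, (u *m A) 0 k <= c 0 k,
    forall i, 0 <= u 0 i & z <= (u *m b) 0 0].
Proof.
move=> Ax0 x0_ge0 cz.
pose W := ('cV[R]_d * R^o)%type.
(* The program is homogenized: the second component of [W] scales [b] and [z]. *)
pose alpha (j : 'I_m + ('I_d + unit)) (w : W) : R :=
  match j with
  | inl i => (A *m w.1) i 0 - b i 0 * w.2
  | inr (inl k) => w.1 k 0
  | inr (inr _) => w.2
  end.
pose gamma (w : W) : R := (c *m w.1) 0 0 - z * w.2.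
have alphaL j : scalar (alpha j).
  case: j => [i|[k|[]]] a x y //=; last by rewrite !mxE.
  by rewrite mulmxDr -scalemxAr !mxE /GRing.scale /=; ring.
have gammaL : scalar gamma.
  move=> a x y; rewrite /gamma /= mulmxDr -scalemxAr !mxE /GRing.scale /=; ring.
have [|l l_ge0 lE] := farkas (s := enum {: 'I_m + ('I_d + unit)})
    (enum_uniq _) alphaL gammaL.
  move=> [x t] w_ge0.
  have {w_ge0}w_ge0 j : 0 <= alpha j (x, t) by apply: w_ge0; rewrite mem_enum.
  have Ax i : b i 0 * t <= (A *m x) i 0.
    by have := w_ge0 (inl i); rewrite /= subr_ge0.
  have x_ge0 k : 0 <= x k 0 := w_ge0 (inr (inl k)).
  have := w_ge0 (inr (inr tt)); rewrite /gamma /= le_eqVlt => /predU1P[t0|t_gt0].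
    (* At scale 0, [x] is a recession direction: if its cost were negative, the feasible point
       [x0 + r *: x] would cost [z - 1]. *)
    rewrite -t0 mulr0 subr0 leNgt; apply/negP => cx_lt0.
    pose r := ((c *m x0) 0 0 - z + 1) / - (c *m x) 0 0.
    have cx0 : z <= (c *m x0) 0 0 by exact: cz.
    have r_ge0 : 0 <= r.
      by apply: divr_ge0; lra.
    have : z <= (c *m (x0 + r *: x)) 0 0.
      apply: cz => [i|k].
        rewrite mulmxDr -scalemxAr [X in _ <= X]mxE [X in _ <= _ + X]mxE.
        by rewrite ler_wpDr // mulr_ge0 //; have := Ax i; rewrite -t0 mulr0.
      by rewrite !mxE addr_ge0 // mulr_ge0.
    rewrite mulmxDr -scalemxAr [X in _ <= X]mxE [X in _ <= _ + X]mxE.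
    have -> : r * (c *m x) 0 0 = - ((c *m x0) 0 0 - z + 1).
      by rewrite /r; field; rewrite lt_eqF.
    lra.
  (* At positive scale, [x / t] is feasible for the original program. *)
  rewrite subr_ge0 -ler_pdivlMr //.
  have -> : (c *m x) 0 0 / t = (c *m (t^-1 *: x)) 0 0.
    by rewrite -scalemxAr [RHS]mxE mulrC.
  apply: cz => [i|k].
    by rewrite -scalemxAr [X in _ <= X]mxE mulrC ler_pdivlMr.
  by rewrite mxE mulr_ge0 // invr_ge0 ltW.
have {}lE w : gamma w = \sum_i l (inl i) * alpha (inl i) w
    + (\sum_k l (inr (inl k)) * w.1 k 0 + l (inr (inr tt)) * w.2).
  rewrite lE big_enum /= big_sumType /= big_sumType /=.
  by rewrite (big_pred1 tt) //; case.
exists (\row_i l (inl i)); split => [k|i|].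
(* A unit vector at scale 0 isolates column [k] and its slack. *)
- have := lE (delta_mx k 0, 0).
  rewrite /gamma /= !mulr0 subr0 addr0 -colE [LHS]mxE => ->.
  have -> : \sum_k' l (inr (inl k')) * (delta_mx k 0 : 'cV[R]_d) k' 0
      = l (inr (inl k)).
    rewrite (bigD1 k) //= big1 => [|k' k'k]; last by rewrite mxE (negPf k'k) mulr0.
    by rewrite mxE !eqxx mulr1 addr0.
  rewrite mxE; under [X in X <= _]eq_bigr do rewrite mxE.
  rewrite [X in _ <= X + _](eq_bigr (fun i => l (inl i) * A i k)) ?lerDl //.
  by move=> i _; rewrite -colE mxE mulr0 subr0.
- by rewrite mxE.
(* Here the identity reads [- z = - u b + l (inr (inr tt))]. *)
have := lE (0, 1); rewrite /gamma /= mulmx0 mxE mulr1 add0r mulr1.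
rewrite (eq_bigr (fun i => - (l (inl i) * b i 0))); last first.
  by move=> i _; rewrite mulmx0 mxE add0r mulr1 mulrN.
rewrite sumrN [X in - _ + (X + _)]big1; last by move=> k _; rewrite mxE mulr0.
rewrite mulmx_row_col; under [in X in _ -> X]eq_bigr do rewrite mxE.
by have := l_ge0 (inr (inr tt)); lra.
Qed.

(** [T] may be infinite, but the objective factors through the finite type [F]. *)
Lemma exists_argmin (R : realDomainType) (T : Type) (F : finType) (f : T -> F)
    (g : F -> R) (P : T -> Prop) :
  (exists a, P a) -> exists2 a, P a & forall a', P a' -> g (f a) <= g (f a').
Proof.
move=> [a Pa]; pose Q y := `[< exists2 a', P a' & f a' = y >].
have Qfa : Q (f a) by apply/asboolP; exists a.
case: (arg_minP g Qfa) => y /asboolP[a' Pa' <-] y_min.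
by exists a' => // a'' Pa''; apply: y_min; apply/asboolP; exists a''.
Qed.

Lemma min_valueE (R : realType) (S : set R) (z : R) :
  S z -> lbound S z -> min_value S = z.
Proof.
move=> Sz Slb; apply: xget_unique => // y [Sy ylb].
by apply/eqP; rewrite eq_le ylb // Slb.
Qed.

(** * Optimal values and reduced costs of the ideal formulation *)

Section Program.
Variables (R : realType) (n : nat) (D : 'I_n -> {fset int}).
Variables (C : set (n.-tuple int)) (c : pairs D -> int).
Variables (m : nat) (A : 'M[R]_(m, #|pairs D|)) (b : 'cV[R]_m).

Lemma char_vecE (a : n.-tuple int) (p : pairs D) :
  char_vec R D a (enum_rank p) 0 = (assigns a p)%:R.
Proof. by rewrite mxE enum_rankK. Qed.

Lemma exists_min_support (P : n.-tuple int -> Prop) :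
  (exists a, P a) ->
  exists2 a, P a &
    forall a', P a' -> cost c (char_vec R D a) <= cost c (char_vec R D a').
Proof.
(* The cost of a tuple depends only on the set of pairs that it assigns. *)
pose g (f : {ffun pairs D -> bool}) : R :=
  cost c (\col_k (f (enum_val k))%:R).
have gE a : cost c (char_vec R D a) = g [ffun p => assigns a p].
  by congr cost; apply/matrixP => k j; rewrite !mxE ffunE.
move=> /(exists_argmin (fun a => [ffun p => assigns a p]) g)[a Pa a_min].
by exists a => // a' Pa'; rewrite !gE; apply: a_min.
Qed.

Lemma conv_sub (d : nat) (S : set 'cV[R]_d) : S `<=` conv S.
Proof.
move=> x Sx; exists 1%N, (fun=> x), (fun=> 1).
by split=> //; rewrite big_ord1 ?scale1r.
Qed.

Lemma conv_ge (d : nat) (S : set 'cV[R]_d) (w : 'rV[R]_d) (z : R) :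
  (forall x, S x -> z <= (w *m x) 0 0) ->
  forall x, conv S x -> z <= (w *m x) 0 0.
Proof.
move=> Sz _ [k [s [l [Ss l_ge0 l1 ->]]]].
rewrite mulmx_sumr summxE -[z]mul1r -l1 mulr_suml; apply: ler_sum => i _.
by rewrite -scalemxAr [X in _ <= X]mxE ler_wpM2l ?Sz.
Qed.

(* A point of the hull with coordinate [k] equal to [1] only combines points
   with that coordinate equal to [1], since the others have it equal to [0]. *)
Lemma conv_face_ge (d : nat) (S : set 'cV[R]_d) (k : 'I_d) (w : 'rV[R]_d)
    (z : R) :
  (forall x, S x -> x k 0 <= 1) ->
  (forall x, S x -> x k 0 = 1 -> z <= (w *m x) 0 0) ->
  forall x, conv S x -> x k 0 = 1 -> z <= (w *m x) 0 0.
Proof.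
move=> S_le1 Sz _ [h [s [l [Ss l_ge0 l1 ->]]]] xk1.
have l_ge0' i : 0 <= l i * (1 - s i k 0).
  by rewrite mulr_ge0 // subr_ge0 S_le1.
have sum0 : \sum_i l i * (1 - s i k 0) = 0.
  under eq_bigr do rewrite mulrBr mulr1.
  rewrite sumrB l1 -xk1 summxE.
  by apply/eqP; rewrite subr_eq0; apply/eqP/eq_bigr => i _; rewrite mxE.
have lE i : l i * (1 - s i k 0) = 0.
  by apply: (psumr_eq0P (P := xpredT) _ sum0).
rewrite mulmx_sumr summxE -[z]mul1r -l1 mulr_suml; apply: ler_sum => i _.
rewrite -scalemxAr [X in _ <= X]mxE.
have /eqP := lE i; rewrite mulf_eq0 => /orP[/eqP ->|]; first by rewrite !mul0r.
by rewrite subr_eq0 eq_sym => /eqP sik1; rewrite ler_wpM2l ?Sz.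
Qed.

Lemma weak_duality (u : 'rV[R]_m) (x : 'cV[R]_#|pairs D|) :
  dual_feasible A c u -> primal_feasible A b x ->
  (u *m b) 0 0 <= (u *m A *m x) 0 0 <= cost c x.
Proof.
move=> [uA u_ge0] [Ax x_ge0]; apply/andP; split.
  rewrite -mulmxA !mulmx_row_col; apply: ler_sum => i _.
  by rewrite ler_wpM2l.
by rewrite /cost !mulmx_row_col; apply: ler_sum => k _; rewrite ler_wpM2r.
Qed.

Lemma reduced_costE (u : 'rV[R]_m) (p : pairs D) :
  reduced_cost A c u p =
    cost_row R c 0 (enum_rank p) - (u *m A) 0 (enum_rank p).
Proof.
rewrite /reduced_cost [cost_row _ _ _ _]mxE enum_rankK.
by rewrite colE mulmxA -colE [in LHS]mxE.
Qed.

(** [cost c x - u A x] is the sum of the nonnegative reduced costs weighted by [x], where [p] has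
    weight 1; and [u b <= u A x]. *)
Lemma reduced_cost_le (u : 'rV[R]_m) (x : 'cV[R]_#|pairs D|) (p : pairs D) :
  dual_feasible A c u -> primal_feasible_at A b p x ->
  reduced_cost A c u p <= cost c x - (u *m b) 0 0.
Proof.
move=> uF [xF xp1].
have /andP[ub _] := weak_duality uF xF; have [uA _] := uF; have [_ x_ge0] := xF.
apply: le_trans (lerB (lexx _) ub).
rewrite /cost !mulmx_row_col -sumrB (bigD1 (enum_rank p)) //= xp1 !mulr1.
rewrite -reduced_costE lerDl; apply: sumr_ge0 => k _.
by rewrite -mulrBl mulr_ge0 // subr_ge0.
Qed.

Hypothesis ideal : primal_feasible A b = conv (char_vecs R D C).

Lemma support_feasible (a : n.-tuple int) :
  is_support D C a -> primal_feasible A b (char_vec R D a).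
Proof. by move=> aS; rewrite ideal; apply: conv_sub; exists a. Qed.

(** Since [min_value] has a default value, a minimizer must be exhibited: a cheapest support, whose
    cost bounds the linear objective on the whole hull. *)
Lemma zoptP : (exists a, is_support D C a) ->
  exists a, [/\ is_support D C a, zopt A b c = cost c (char_vec R D a)
    & forall x, primal_feasible A b x -> zopt A b c <= cost c x].
Proof.
move=> /exists_min_support[a aS a_min].
have lb x : primal_feasible A b x -> cost c (char_vec R D a) <= cost c x.
  by rewrite ideal; apply: conv_ge => _ [a' a'S <-]; apply: a_min.
have zE : zopt A b c = cost c (char_vec R D a).
  apply: min_valueE; last by move=> _ [x xF <-]; apply: lb.
  by exists (char_vec R D a) => //; apply: support_feasible.
by exists a; rewrite zE.
Qed.

Lemma zopt_atP (p : pairs D) :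
  (exists a, is_support D C a /\ assigns a p) ->
  exists a, [/\ is_support D C a, assigns a p,
    zopt_at A b c p = cost c (char_vec R D a)
    & forall a', is_support D C a' -> assigns a' p ->
        zopt_at A b c p <= cost c (char_vec R D a')].
Proof.
move=> /exists_min_support[a [aS ap] a_min].
have zE : zopt_at A b c p = cost c (char_vec R D a).
  apply: min_valueE.
    exists (char_vec R D a) => //.
    by split; [exact: support_feasible|rewrite char_vecE ap].
  move=> _ [x [xF xp] <-]; rewrite ideal in xF.
  apply: conv_face_ge xF xp => _ [a' a'S <-]; rewrite char_vecE.
    by case: assigns; rewrite ?lexx ?ler01.
  move=> /eqP; case: (boolP (assigns a' p)) => [a'p _|_]; first exact: a_min.
  by rewrite eq_sym oner_eq0.
by exists a; split=> // a' a'S a'p; rewrite zE; apply: a_min.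
Qed.

End Program.

Theorem corollary2 (R : realType) (n : nat) (D : 'I_n -> {fset int})
    (C : set (n.-tuple int)) (c : pairs D -> int)
    (m : nat) (A : 'M[R]_(m, #|pairs D|)) (b : 'cV[R]_m)
    (ideal : primal_feasible A b = conv (char_vecs R D C))
    (consistent : exists a : n.-tuple int, is_support D C a)
    (feasible : forall p : pairs D,
      exists a : n.-tuple int, is_support D C a /\ assigns a p)
    (I : {set pairs D})
    (incompat : forall p q : pairs D,
      p \in I -> q \in I -> p != q -> incompatible C p q) :
  exists u : 'rV[R]_m,
    dual_optimal A b c u /\
    forall p : pairs D, p \in I ->
      reduced_cost A c u p = exact_reduced_cost A b c p.
Proof.
pose r p : R := if p \in I then exact_reduced_cost A b c p else 0.
have [a0 [a0S z_a0 z_min]] := zoptP c ideal consistent.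
have [Aa0 a0_ge0] := support_feasible ideal a0S.
have r_ge0 p : 0 <= r p.
  rewrite /r; case: ifP => // _; rewrite subr_ge0.
  have [a [aS _ -> _]] := zopt_atP c ideal (feasible p).
  exact: z_min (support_feasible ideal aS).
pose w : 'rV[R]_#|pairs D| := \row_k ((c (enum_val k))%:~R - r (enum_val k)).
have wE (a : n.-tuple int) : (w *m char_vec R D a) 0 0
    = cost c (char_vec R D a) - \sum_(p | assigns a p) r p.
  rewrite [X in _ - X]big_mkcond (reindex (@enum_val (pairs D) predT)) /=;
    last by apply: onW_bij; apply: enum_val_bij.
  rewrite /cost !mulmx_row_col -sumrB; apply: eq_bigr => k _.
  by rewrite !mxE mulrBl; case: assigns; rewrite ?mulr1 ?mulr0.
have w_ge a : is_support D C a ->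
    zopt A b c <= (w *m char_vec R D a) 0 0.
  move=> aS; rewrite wE.
  have [/existsP[p /andP[pI ap]]|/existsPn noI] :=
      boolP [exists p, (p \in I) && assigns a p].
    (* By incompatibility [p] is the only pair of [I] in the support, so exactly [R_p] is subtracted
       from a cost of at least [z* + R_p]. *)
    rewrite (bigD1 p) //= big1 => [|q /andP[aq qp]]; last first.
      rewrite /r; case: ifP => // qI.
      by have [_ []] := incompat q p qI pI qp; exists a.
    rewrite addr0 /r pI /exact_reduced_cost.
    have [_ [_ _ _ /(_ a aS ap)]] := zopt_atP c ideal (feasible p).
    lra.
  rewrite big1 ?subr0; first exact: z_min (support_feasible ideal aS).
  by move=> p ap; have := noI p; rewrite ap andbT /r => /negPf ->.
have [|u [uw u_ge0 zu]] := lp_bound_dual (c := w) (z := zopt A b c) Aa0 a0_ge0.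
  move=> x Ax x_ge0.
  have : primal_feasible A b x by [].
  by rewrite ideal; apply: conv_ge => _ [a aS <-]; apply: w_ge.
have uF : dual_feasible A c u.
  split=> // k; apply: le_trans (uw k) _.
  by rewrite !mxE gerBl r_ge0.
exists u; split.
  (* Every dual value is at most the cost [z*] of [a0], hence at most [u b]. *)
  split=> // v vF; apply: le_trans zu; rewrite z_a0.
  by have /andP[] := weak_duality vF (support_feasible ideal a0S); apply: le_trans.
move=> p pI; apply/eqP; rewrite eq_le; apply/andP; split.
  have [a [aS ap zE _]] := zopt_atP c ideal (feasible p).
  rewrite /exact_reduced_cost zE.
  apply: le_trans (lerB (lexx _) zu); apply: reduced_cost_le => //.
  by split; [exact: support_feasible aS|rewrite char_vecE ap].
(* The lowered dual constraint at [p] is [u A_p <= c_p - R_p]. *)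
have := uw (enum_rank p); rewrite reduced_costE /w !mxE enum_rankK /r pI.
lra.
Qed.
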